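(* Let $m\ge3$ be an odd integer, $M=\mathrm{diag}(2,m)$, and $n\in\mathbb{N}$, $n\ge1$. The anisotropic subdivision scheme $\mathcal{S}_{\mathbf{a}_{M,n}}$ of order $n$ and dilation matrix $M$ is interpolatory; that is, its mask satisfies $$\mathrm{a}_{M,n}(\mathbf{0})=1\qquad\text{and}\qquad \mathrm{a}_{M,n}(M\boldsymbol{\alpha})=0\quad\text{for all }\boldsymbol{\alpha}\in\mathbb{Z}^2\setminus\{\mathbf{0}\}.$$
   Context: For integers $r\ge2$ and $k\ge1$, the symbol of the univariate $(2k)$-point Dubuc–Deslauriers interpolatory subdivision scheme of dilation $r$ is the Laurent polynomial $$a_{r,k}(z)=1+\sum_{\varepsilon=1}^{r-1}\sum_{\beta=-k+1}^{k}\frac{(-1)^{\beta+k}}{(2k-1)!\,(\varepsilon/r-\beta)}\binom{2k-1}{k-\beta}\Bigl(-k+1-\frac{\varepsilon}{r}\Bigr)_{2k}\,z^{-r\beta+\varepsilon},\qquad z\in\mathbb{C}\setminus\{0\},$$ where $(x)_0=1$ and $(x)_\ell=x(x+1)\cdots(x+\ell-1)$. The anisotropic subdivision scheme $\mathcal{S}_{\mathbf{a}_{M,n}}$ of order $n$ and dilation matrix $M=\mathrm{diag}(2,m)$ is defined by its symbol $$a_{M,n}(z_1,z_2)=\sum_{k=0}^{n-1}a_{2,n-k}(z_1)\,a_{m,k+1}(z_2)-\sum_{k=0}^{n-2}a_{2,n-k-1}(z_1)\,a_{m,k+1}(z_2),$$ and its mask $\mathbf{a}_{M,n}$ is given by the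 coefficients: $a_{M,n}(\mathbf{z})=\sum_{\boldsymbol{\alpha}\in\mathbb{Z}^2}\mathrm{a}_{M,n}(\boldsymbol{\alpha})\,z_1^{\alpha_1}z_2^{\alpha_2}$. The associated subdivision operator is $(\mathcal{S}_{\mathbf{a}_{M,n}}\mathbf{c})(\boldsymbol{\alpha})=\sum_{\boldsymbol{\beta}\in\mathbb{Z}^2}\mathrm{a}_{M,n}(\boldsymbol{\alpha}-M\boldsymbol{\beta})\mathrm{c}(\boldsymbol{\beta})$. *)

(* Defs.v *)
From mathcomp Require Import all_boot all_order all_algebra.
From mathcomp Require Import finmap.
From mathcomp Require Import boolp classical_sets reals.
From mathcomp.real_closed Require Export complex.

Set Implicit Arguments.
Unset Strict Implicit.
Unset Printing Implicit Defensive.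
Import GRing.Theory Num.Theory.
Local Open Scope ring_scope.

Section Subdivision.
Variable R : realType.
Local Notation C := R[i].

(* (x)_l = x (x + 1) ... (x + l - 1) *)
Definition rising_factorial (x : C) (l : nat) : C := \prod_(i < l) (x + i%:R).

(* The coefficient of z^(- r beta + eps); for - k + 1 <= beta <= k both
   k - beta and beta + k are nonnegative, so the absolute value and the
   integer power are those of natural numbers. *)
Definition dd_coef (r k eps : nat) (beta : int) : C :=
  (-1) ^ (beta + k%:Z)
    / ((2 * k - 1)`!%:R * (eps%:R / r%:R - beta%:~R))
  * 'C(2 * k - 1, `|k%:Z - beta|%N)%:R
  * rising_factorial (- k%:R + 1 - eps%:R / r%:R) (2 * k).

(* beta = - k + 1 + j runs over - k + 1, ..., k. *)
Definition dd_symbol (r k : nat) (z : C) : C :=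
  1 + \sum_(1 <= eps < r) \sum_(0 <= j < 2 * k)
        let beta := - k%:Z + 1 + j%:Z in
        dd_coef r k eps beta * z ^ (- (r%:Z * beta) + eps%:Z).

Definition aniso_symbol (m n : nat) (z1 z2 : C) : C :=
  \sum_(0 <= k < n) dd_symbol 2 (n - k) z1 * dd_symbol m k.+1 z2
  - \sum_(0 <= k < n.-1) dd_symbol 2 (n - k - 1) z1 * dd_symbol m k.+1 z2.

(* Points of Z^2 are column vectors, with coordinates alpha 0 0 and
   alpha 1 0, so that a dilation matrix M acts by M *m alpha. *)
Definition mask2 := {fsfun 'cV[int]_2 -> C with 0}.

Definition laurent_eval (a : mask2) (z1 z2 : C) : C :=
  \sum_(alpha <- finsupp a) a alpha * z1 ^ alpha 0 0 * z2 ^ alpha 1 0.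

Definition is_mask_of (A : C -> C -> C) (a : mask2) : Prop :=
  forall z1 z2 : C, z1 != 0 -> z2 != 0 -> A z1 z2 = laurent_eval a z1 z2.

(* The finitely supported family of coefficients of the Laurent polynomial
   function A on (C \ {0})^2; the junk value, when A is not one, is 0. *)
Definition mask_of (A : C -> C -> C) : mask2 :=
  xget ([fsfun] : mask2) [set a | is_mask_of A a]%classic.

Definition aniso_mask (m n : nat) : mask2 := mask_of (aniso_symbol m n).

Definition interpolatory (M : 'M[int]_2) (a : mask2) : Prop :=
  a 0 = 1 /\ forall alpha : 'cV[int]_2, alpha != 0 -> a (M *m alpha) = 0.

End Subdivision.

Definition aniso_dilation (m : nat) : 'M[int]_2 :=
  diag_mx (\row_(j < 2) if j == 0 then 2 else m%:Z).

(* Main.v *)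
Require Import Defs.
From mathcomp Require Import all_boot all_order all_algebra.
From mathcomp Require Import reals.
From mathcomp Require Import finmap boolp classical_sets.
From mathcomp Require Import ring.

(** Being interpolatory can be read off from the exponents that occur in the
    symbols.  In [dd_symbol r k] the exponents besides that of the constant
    term 1 are [- r beta + eps] with [0 < eps < r], hence not divisible by [r]
    ([dd_symbol_terms]).  Therefore a product [dd_symbol 2 k z1 * dd_symbol m l z2] is 1 plus monomials whose
    exponents lie outside the lattice [M Z^2] ([dd_product_off_lattice]), since
    every monomial other than 1 has a factor with a nondivisible exponent.
    The symbol of order [n] is a sum of [n] such products minus a sum of
    [n - 1] of them, so the constant terms add up to [n - (n - 1) = 1], and
    the symbol is again 1 plus monomials with exponents outside [M Z^2].

    It remains to see that the mask really reads off these coefficients, that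
    is, that a Laurent polynomial function on the torus determines its
    coefficients ([coef_eq0]).  The numbers [2^a 3^b], for [(a, b)] in [Z^2],
    are pairwise distinct ([node_inj]); evaluating at the points
    [(2^j, 3^j)] turns the vanishing of the function into the vanishing of the moments
    [sum_alpha c_alpha x_alpha^j] of distinct nodes, and integrating a
    polynomial that vanishes at all nodes but one isolates each coefficient. *)

Set Implicit Arguments.
Unset Strict Implicit.
Unset Printing Implicit Defensive.
Import GRing.Theory Num.Theory.
Local Open Scope ring_scope.

(** * Coefficients of Laurent polynomial functions *)

Section Coefficients.
Variable R : realType.
Local Notation C := R[i].

(** A Laurent polynomial as an unreduced list of terms, in which an exponent
    may be repeated: sums are then concatenations. *)
Definition eval_terms (s : seq (C * 'cV[int]_2)) (z1 z2 : C) : C :=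
  \sum_(t <- s) t.1 * z1 ^ t.2 0 0 * z2 ^ t.2 1 0.

Definition coef_terms (s : seq (C * 'cV[int]_2)) (alpha : 'cV[int]_2) : C :=
  \sum_(t <- s | t.2 == alpha) t.1.

(** By parity: [3 ^ b] is odd, which forces [a = 0]. *)
Lemma expn2_eq_expn3 (a b : nat) : (2 ^ a = 3 ^ b)%N -> a = 0%N /\ b = 0%N.
Proof.
case: a => [|a] e; last by have := congr1 odd e; rewrite !oddX /= orbT.
by split=> //; move/eqP: e; rewrite expn0 -(expn0 3) eqn_exp2l // => /eqP.
Qed.

Lemma exprz2_eq_exprz3 (a b : int) :
  (2 : C) ^ a = (3 : C) ^ b -> a = 0 /\ b = 0.
Proof.
have pos (x y : nat) : (2 : C) ^+ x = 3 ^+ y -> x = 0%N /\ y = 0%N.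
  by rewrite -!natrX => /eqP; rewrite eqr_nat => /eqP/expn2_eq_expn3.
have neg (x y : nat) : (2 : C) ^+ x * 3 ^+ y = 1 -> x = 0%N /\ y = 0%N.
  rewrite -!natrX -natrM => /eqP.
  rewrite (eqr_nat _ _ 1) muln_eq1 => /andP[/eqP x1 /eqP y1].
  have [-> _] := @expn2_eq_expn3 x 0 x1.
  by have [_ ->] := @expn2_eq_expn3 0 y (esym y1).
have nz (k x : nat) : (k.+1%:R : C) ^+ x != 0 by rewrite expf_neq0 ?pnatr_eq0.
case: a => a; case: b => b; rewrite ?NegzE ?exprnN -?exprnP => e.
- by have [-> ->] := pos _ _ e.
- have [] // := neg a b.+1.
  by rewrite e mulVf ?(nz 2%N).
- have [] // := neg a.+1 b.
  by rewrite -e mulfV ?(nz 1%N).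
- by have [] := pos _ _ (invr_inj e).
Qed.

(** The value of the monomial with exponent [alpha] at the point [(2, 3)]; two
    multiplicatively independent numbers keep the exponents apart. *)
Definition node (alpha : 'cV[int]_2) : C := 2 ^ alpha 0 0 * 3 ^ alpha 1 0.

(** [node alpha = node beta] separates into an equality between a power of 2
    and a power of 3, with exponents the differences of the coordinates. *)
Lemma node_inj : injective node.
Proof.
move=> alpha beta e.
have nz2 : (2 : C) != 0 by rewrite pnatr_eq0.
have nz3 : (3 : C) != 0 by rewrite pnatr_eq0.
have [/eqP a0 /eqP b0] : alpha 0 0 - beta 0 0 = 0 /\ beta 1 0 - alpha 1 0 = 0.
  apply: exprz2_eq_exprz3; rewrite !expfzDr // -!invr_expz.
  apply/eqP; rewrite eqr_div ?expfz_neq0 //; apply/eqP.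
  by rewrite [RHS]mulrC.
apply/colP=> i; apply/eqP.
have /orP[/eqP ->|/eqP ->] : (i == 0) || (i == 1) by case: i => [[|[|i]]].
  by rewrite -subr_eq0.
by rewrite eq_sym -subr_eq0.
Qed.

(** The points [(2^j, 3^j)] give the moments of the measure with weights
    [t.1] at the points [node t.2], so this measure integrates every polynomial
    to 0. *)
Lemma sum_horner_node (s : seq (C * 'cV[int]_2)) (p : {poly C}) :
  (forall z1 z2, z1 != 0 -> z2 != 0 -> eval_terms s z1 z2 = 0) ->
  \sum_(t <- s) t.1 * p.[node t.2] = 0.
Proof.
move=> s0.
under eq_bigr do rewrite horner_coef mulr_sumr.
rewrite exchange_big big1 // => j _ /=.
transitivity (p`_j * eval_terms s (2 ^+ j) (3 ^+ j)); last first.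
  by rewrite s0 ?mulr0 // expf_neq0 ?pnatr_eq0.
rewrite mulr_sumr; apply: eq_bigr => t _.
rewrite /node exprMn !exprnP ![(_ ^ j) ^ _]exprzAC.
ring.
Qed.

(** The polynomial whose roots are the nodes of all exponents other than
    [alpha] kills every term of the moment identity except those at [alpha],
    where its value is nonzero because distinct exponents have distinct
    nodes. *)
Lemma coef_eq0 (s : seq (C * 'cV[int]_2)) (alpha : 'cV[int]_2) :
  (forall z1 z2, z1 != 0 -> z2 != 0 -> eval_terms s z1 z2 = 0) ->
  coef_terms s alpha = 0.
Proof.
move=> s0.
pose p := \prod_(t <- s | t.2 != alpha) ('X - (node t.2)%:P).
have := sum_horner_node p s0.
rewrite (bigID (fun t => t.2 == alpha)) /= [X in _ + X]big_seq_cond.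
rewrite [X in _ + X]big1 ?addr0; last first.
  move=> t /andP[ts talpha]; rewrite (_ : p.[_] = 0) ?mulr0 //.
  rewrite horner_prod; apply/eqP; rewrite prodf_seq_eq0; apply/hasP.
  by exists t => //; rewrite talpha hornerXsubC subrr eqxx.
under eq_bigr => t talpha do rewrite (eqP talpha).
rewrite -mulr_suml => /eqP; rewrite mulf_eq0 => /orP[/eqP //|].
rewrite horner_prod prodf_seq_eq0 => /hasP[t _ /andP[talpha]].
rewrite hornerXsubC subr_eq0 => /eqP/node_inj e.
by rewrite e eqxx in talpha.
Qed.

Lemma laurent_eval_terms (a : mask2 R) (z1 z2 : C) :
  laurent_eval a z1 z2 =
  eval_terms [seq (a alpha, alpha) | alpha <- finsupp a] z1 z2.
Proof. by rewrite /eval_terms big_map. Qed.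

Lemma mask_coef_terms (a : mask2 R) (alpha : 'cV[int]_2) :
  coef_terms [seq (a beta, beta) | beta <- finsupp a] alpha = a alpha.
Proof.
rewrite /coef_terms big_map /=.
have [ain|aout] := boolP (alpha \in finsupp a).
  by rewrite -big_filter filter_pred1_uniq ?fset_uniq // big_seq1.
rewrite (fsfun_dflt aout) big_seq_cond big1 // => i /andP[iin /eqP e].
by rewrite -e iin in aout.
Qed.



Lemma eval_terms_coef (s : seq (C * 'cV[int]_2)) (r : seq 'cV[int]_2) z1 z2 :
  uniq r -> {subset [seq t.2 | t <- s] <= r} ->
  eval_terms s z1 z2 =
  \sum_(alpha <- r) coef_terms s alpha * (z1 ^ alpha 0 0 * z2 ^ alpha 1 0).
Proof.
move=> r_uniq sub_r; under [RHS]eq_bigr do rewrite mulr_suml.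
rewrite (exchange_big_dep xpredT) //= /eval_terms big_seq [RHS]big_seq.
apply: eq_bigr => t ts.
have tr : t.2 \in r by apply: sub_r; apply: map_f.
rewrite -big_filter (_ : [seq _ <- r | _] = [:: t.2]) ?big_seq1 ?mulrA //.
by under eq_filter do rewrite eq_sym; rewrite filter_pred1_uniq.
Qed.

Lemma eq_eval_terms (s s' : seq (C * 'cV[int]_2)) z1 z2 :
  coef_terms s =1 coef_terms s' -> eval_terms s z1 z2 = eval_terms s' z1 z2.
Proof.
move=> ss'; pose r := undup ([seq t.2 | t <- s] ++ [seq t.2 | t <- s']).
rewrite !(@eval_terms_coef _ r) ?undup_uniq //.
- by apply: eq_bigr => alpha _; rewrite ss'.
- by move=> x xs; rewrite mem_undup mem_cat xs orbT.
- by move=> x xs; rewrite mem_undup mem_cat xs.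
Qed.

(** [mask_of] falls back to the zero mask when no mask represents the function,
    so the existence of one has to be shown by collecting the repeated exponents
    of [s]. *)
Lemma exists_mask (s : seq (C * 'cV[int]_2)) :
  exists a : mask2 R, forall z1 z2, laurent_eval a z1 z2 = eval_terms s z1 z2.
Proof.
pose S := seq_fset tt [seq t.2 | t <- s].
exists [fsfun alpha in S => coef_terms s alpha | 0] => z1 z2.
rewrite laurent_eval_terms; apply: eq_eval_terms => alpha.
rewrite mask_coef_terms fsfun_fun seq_fsetE; case: ifPn => // aout.
apply/esym/big1_seq => t /andP[/eqP e ts].
by case/negP: aout; rewrite -e map_f.
Qed.

(** The terms of the mask, together with the opposites of those of [s], form a
    Laurent polynomial that vanishes on the torus. *)
Lemma mask_of_terms (A : C -> C -> C) (s : seq (C * 'cV[int]_2)) alpha :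
  (forall z1 z2, z1 != 0 -> z2 != 0 -> A z1 z2 = eval_terms s z1 z2) ->
  mask_of A alpha = coef_terms s alpha.
Proof.
move=> As; have [a0 a0s] := exists_mask s.
have Aa : is_mask_of A (mask_of A).
  by apply: xgetPex; exists a0 => z1 z2 nz1 nz2; rewrite As ?a0s.
set a := mask_of A in Aa *.
pose d := [seq (a beta, beta) | beta <- finsupp a]
  ++ [seq (- t.1, t.2) | t <- s].
have : coef_terms d alpha = 0.
  apply: coef_eq0 => z1 z2 nz1 nz2.
  rewrite /eval_terms big_cat -!/(eval_terms _ _ _).
  rewrite -laurent_eval_terms -Aa // As // /eval_terms big_map /=.
  by rewrite -big_split big1 // => t _ /=; ring.
rewrite /coef_terms big_cat -!/(coef_terms _ _) mask_coef_terms.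
by rewrite /coef_terms big_map sumrN => /eqP; rewrite subr_eq0 => /eqP.
Qed.

(** * Laurent polynomials with prescribed exponents *)

(** Some presentation of [f] by monomials has all its exponents in [D]; this
    form makes the property stable under sums and opposites term by term. *)
Definition supported_in (D : pred 'cV[int]_2) (f : C -> C -> C) :=
  exists2 s : seq (C * 'cV[int]_2),
    {in s, forall t, D t.2} & forall z1 z2, f z1 z2 = eval_terms s z1 z2.

Lemma eq_supported_in (D : pred 'cV[int]_2) (f g : C -> C -> C) :
  (forall z1 z2, f z1 z2 = g z1 z2) -> supported_in D g -> supported_in D f.
Proof. by move=> fg [s Ds gs]; exists s => // z1 z2; rewrite fg. Qed.

Lemma supported_in_monomial (D : pred 'cV[int]_2) (c : C) alpha :
  D alpha -> supported_in D (fun z1 z2 => c * z1 ^ alpha 0 0 * z2 ^ alpha 1 0).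
Proof.
move=> Da; exists [:: (c, alpha)] => [t|z1 z2]; last first.
  by rewrite /eval_terms big_seq1.
by rewrite inE => /eqP ->.
Qed.

Lemma supported_inD (D : pred 'cV[int]_2) (f g : C -> C -> C) :
  supported_in D f -> supported_in D g ->
  supported_in D (fun z1 z2 => f z1 z2 + g z1 z2).
Proof.
move=> [s Ds fs] [s' Ds' gs']; exists (s ++ s') => [t|z1 z2].
  by rewrite mem_cat => /orP[/Ds|/Ds'].
by rewrite fs gs' /eval_terms big_cat.
Qed.

Lemma supported_inN (D : pred 'cV[int]_2) (f : C -> C -> C) :
  supported_in D f -> supported_in D (fun z1 z2 => - f z1 z2).
Proof.
move=> [s Ds fs]; exists [seq (- t.1, t.2) | t <- s].
  by move=> _ /mapP[t /Ds Dt ->].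
move=> z1 z2.
by rewrite fs /eval_terms big_map -sumrN; apply: eq_bigr => t _; rewrite !mulNr.
Qed.

Lemma supported_in_sum (D : pred 'cV[int]_2) (I : eqType) (r : seq I)
    (F : I -> C -> C -> C) :
  {in r, forall i, supported_in D (F i)} ->
  supported_in D (fun z1 z2 => \sum_(i <- r) F i z1 z2).
Proof.
elim: r => [|i r IHr] DF.
  by exists [::] => // z1 z2; rewrite /eval_terms !big_nil.
apply: (eq_supported_in (g := fun z1 z2 => F i z1 z2 + \sum_(j <- r) F j z1 z2)).
  by move=> z1 z2; rewrite big_cons.
apply: supported_inD; first by apply: DF; rewrite mem_head.
by apply: IHr => j jr; apply: DF; rewrite inE jr orbT.
Qed.

(** * The exponents of the symbols *)

(** Modulo [r], the exponent [- r beta + eps] is [eps], which lies strictly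
    between 0 and [r]. *)
Lemma dd_symbol_terms (r k : nat) :
  exists2 s : seq (C * int), {in s, forall t, ~~ (r%:Z %| t.2)%Z} &
    forall z : C, dd_symbol r k z = 1 + \sum_(t <- s) t.1 * z ^ t.2.
Proof.
pose beta (j : nat) := - k%:Z + 1 + j%:Z.
exists [seq (dd_coef R r k eps (beta j), - (r%:Z * beta j) + eps%:Z)
  | eps <- index_iota 1 r, j <- index_iota 0 (2 * k)]; last first.
  by move=> z; rewrite big_allpairs_dep.
move=> _ /allpairsP[[eps j] [/= + _ ->]] /=.
rewrite mem_index_iota => /andP[eps0 epsr].
by rewrite rpredDl ?rpredN ?dvdz_mulr // dvdzE /= gtnNdvd.
Qed.

(** The complement of the lattice [M Z^2] for [M = diag(2, m)]. *)
Definition off_lattice (m : nat) : pred 'cV[int]_2 :=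
  [pred alpha : 'cV[int]_2 | ~~ ((2 %| alpha 0%R 0%R)%Z && (m%:Z %| alpha 1%R 0%R)%Z)].

(** Expand [(1 + S) (1 + T) - 1 = S + (T + S T)]: monomials with a factor from
    [S] have a first exponent that is odd, and those of [T] have a second
    exponent that [m] does not divide. *)
Lemma dd_product_off_lattice (m k l : nat) :
  supported_in (off_lattice m)
    (fun z1 z2 => dd_symbol 2 k z1 * dd_symbol m l z2 - 1).
Proof.
have [s s2 Es] := dd_symbol_terms 2 k; have [t tm Et] := dd_symbol_terms m l.
pose vec (a b : int) : 'cV[int]_2 := \col_i if i == 0 then a else b.
have monomial c a b : ~~ ((2 %| a)%Z && (m%:Z %| b)%Z) ->
    supported_in (off_lattice m) (fun z1 z2 => c * z1 ^ a * z2 ^ b).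
  move=> ab; have := @supported_in_monomial (off_lattice m) c (vec a b).
  by rewrite /off_lattice /= !mxE /=; apply.
apply: (eq_supported_in (g := fun z1 z2 =>
  \sum_(u <- s) u.1 * z1 ^ u.2 * z2 ^ 0
  + (\sum_(v <- t) v.1 * z1 ^ 0 * z2 ^ v.2
     + \sum_(u <- s) \sum_(v <- t) u.1 * v.1 * z1 ^ u.2 * z2 ^ v.2))).
  move=> z1 z2; rewrite Es Et !expr0z.
  under [X in _ = X + _]eq_bigr do rewrite mulr1.
  under [X in _ = _ + (X + _)]eq_bigr do rewrite mulr1.
  have -> : \sum_(u <- s) \sum_(v <- t) u.1 * v.1 * z1 ^ u.2 * z2 ^ v.2 =
      (\sum_(u <- s) u.1 * z1 ^ u.2) * \sum_(v <- t) v.1 * z2 ^ v.2.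
    rewrite mulr_suml; apply: eq_bigr => u _; rewrite mulr_sumr.
    by apply: eq_bigr => v _; ring.
  ring.
apply: supported_inD; last apply: supported_inD.
- by apply: supported_in_sum => u /s2 u2; apply: monomial; rewrite negb_and u2.
- apply: supported_in_sum => v /tm vm; apply: monomial.
  by rewrite negb_and vm orbT.
- apply: supported_in_sum => u /s2 u2; apply: supported_in_sum => v _.
  by apply: monomial; rewrite negb_and u2.
Qed.

(** There are [n] added products and [n - 1] subtracted ones, each 1 plus
    monomials off the lattice; hence the constant term is
    [n - (n - 1) = 1]. *)
Lemma aniso_symbol_off_lattice (m n : nat) : (1 <= n)%N ->
  supported_in (off_lattice m) (fun z1 z2 => aniso_symbol m n z1 z2 - 1).
Proof.
case: n => // n _.
pose F k l (z1 z2 : C) := dd_symbol 2 k z1 * dd_symbol m l z2 - 1.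
apply: (eq_supported_in (g := fun z1 z2 =>
  \sum_(k <- index_iota 0 n.+1) F (n.+1 - k)%N k.+1 z1 z2
  - \sum_(k <- index_iota 0 n) F (n.+1 - k - 1)%N k.+1 z1 z2)).
  move=> z1 z2; rewrite /aniso_symbol /F !big_split /=.
  by rewrite !sumr_const_nat !subn0 mulrS; ring.
apply: supported_inD; last apply: supported_inN.
  by apply: supported_in_sum => k _; apply: dd_product_off_lattice.
by apply: supported_in_sum => k _; apply: dd_product_off_lattice.
Qed.

End Coefficients.

Lemma aniso_dilationE (m : nat) (alpha : 'cV[int]_2) :
  (aniso_dilation m *m alpha) 0 0 = 2 * alpha 0 0
  /\ (aniso_dilation m *m alpha) 1 0 = m%:Z * alpha 1 0.
Proof. by rewrite /aniso_dilation mul_diag_mx !mxE. Qed.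

Theorem proposition3p3 (R : realType) (m n : nat)
    (hm3 : (3 <= m)%N) (hm_odd : odd m) (hn : (1 <= n)%N) :
  interpolatory (aniso_dilation m) (aniso_mask R m n).
Proof.
have [s s_off Es] := aniso_symbol_off_lattice R m hn.
have maskE alpha : aniso_mask R m n alpha = coef_terms ((1, 0) :: s) alpha.
  apply: mask_of_terms => z1 z2 _ _.
  rewrite /eval_terms big_cons /= !mxE !expr0z !mulr1 -/(eval_terms _ _ _) -Es.
  by rewrite addrC subrK.
have lattice_coef0 alpha : ~~ off_lattice m alpha -> coef_terms s alpha = 0.
  move=> a_in; apply: big1_seq => t /andP[/eqP e /s_off].
  by rewrite e (negPf a_in).
split=> [|alpha alpha0].
  rewrite maskE /coef_terms big_cons /= eqxx -/(coef_terms _ _).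
  by rewrite lattice_coef0 ?addr0 // /off_lattice /= !mxE !dvdz0.
(* [M alpha] could only meet the constant term if [alpha = 0], since [2] and
   [m] are nonzero. *)
have [M0 M1] := aniso_dilationE m alpha.
rewrite maskE /coef_terms big_cons /= -/(coef_terms _ _) lattice_coef0; last first.
  by rewrite /off_lattice /= M0 M1 !dvdz_mulr.
case: eqP => // e; case/negP: alpha0; apply/eqP/colP=> i.
move: M0 M1; rewrite -e !mxE => /esym/eqP + /esym/eqP.
have m0 : (m%:Z == 0) = false by case: (m) hm3.
rewrite !mulf_eq0 m0 /= => /eqP a0 /eqP a1.
by have /orP[/eqP ->|/eqP ->] : (i == 0) || (i == 1) by case: i => [[|[|i]]].
Qed.
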